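(* Let $\lambda,\mu,R,C>0$, $\rho=\lambda/\mu$ and $\nu=R\mu/C$. Under grouped customer behavior, let $p_r^{(gr)}$ be the provider's revenue-maximizing fee, $q_r^{(gr)}$ the joining fraction it induces, and $q_{soc}$ the socially optimal joining fraction. (i) If $\nu\le 1$, then $q_r^{(gr)}=q_{soc}=0$. (ii) If $\nu>1$, then $q_r^{(gr)}\le q_{soc}$, and $q_r^{(gr)}=q_{soc}$ holds if and only if $q_r^{(gr)}=1$ (that is, revenue maximization is socially efficient only when it captures the whole market). Moreover, the customer surplus under revenue maximization is strictly positive: $$\lambda q_r^{(gr)}\left(R-p_r^{(gr)}-\frac{C}{\mu-\lambda q_r^{(gr)}}\right)>0.$$
   Context: Setting: unobservable M/M/1 queue with potential Poisson arrival rate $\lambda>0$, service rate $\mu>0$, service reward $R>0$, waiting cost rate $C>0$ per unit of time in system, and entrance fee $p\in[0,R)$. Put $\rho=\lambda/\mu$ (any positive value allowed), $\nu=R\mu/C$ and $\nu(p)=(R-p)\mu/C$. If a fraction $q\in[0,1]$ of customers joins and $\rho q<1$, the mean sojourn time is $\frac{1}{\mu(1-\rho q)}$; if $\rho q\ge 1$ the expected waiting cost is infinite, so such $q$ are excluded. Grouped behavior: $q_e^{(gr)}(p)$ is the unique maximizer, over $q\in[0,1]$ with $\rho q<1$, of the aggregate customer surplus per unit time $\mathcal U^{(gr)}(q;p)=\lambda q\left(R-p-\frac{C}{\mu-\lambda q}\right)=C\rho q\left(\nu(p)-\frac{1}{1-\rho q}\right)$. Provider: the revenue per unit time at fee $p$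 is $\overline R^{(gr)}(p)=\lambda\, q_e^{(gr)}(p)\,p$. When $\nu>1$, $p_r^{(gr)}$ is the (unique) fee in $[0,R)$ maximizing $\overline R^{(gr)}$. When $\nu\le 1$, revenue is zero at every fee and one sets $p_r^{(gr)}=0$ as a normalization. In both cases $q_r^{(gr)}=q_e^{(gr)}(p_r^{(gr)})$. Social welfare: $SW(q)=\lambda q\left(R-\frac{C}{\mu-\lambda q}\right)=C\rho q\left(\nu-\frac{1}{1-\rho q}\right)$ for $q\in[0,1]$ with $\rho q<1$, and $q_{soc}$ is its unique maximizer over this set, $q_{soc}=\min\left\{\frac1\rho\left(1-\sqrt{1/\nu}\right)^+,1\right\}$, where $x^+=\max(x,0)$. *)

(* Defs.v *)
From Stdlib Require Import Reals ClassicalEpsilon.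
Open Scope R_scope.

(** Unobservable M/M/1 queue: [lambda] arrival rate, [mu] service rate,
    [r] service reward, [c] waiting cost per unit of time, [p] entrance fee,
    [q] joining fraction. *)

Definition is_maximizer (D : R -> Prop) (f : R -> R) (x : R) : Prop :=
  D x /\ forall y : R, D y -> f y <= f x.

(** The unique maximizer of [f] over [D].  The choice ranges over
    [unique (is_maximizer D f)], so the value is unspecified unless a
    maximizer exists and is unique. *)
Definition argmax (D : R -> Prop) (f : R -> R) : R :=
  epsilon (inhabits 0) (unique (is_maximizer D f)).

Definition rho (lambda mu : R) : R := lambda / mu.

Definition nu (mu r c : R) : R := r * mu / c.

(** Fractions with [rho * q >= 1] are excluded: their expected waiting cost is
    infinite.  The denominators [mu - lambda * q] below are thus positive. *)
Definition admissible_fraction (lambda mu q : R) : Prop :=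
  0 <= q <= 1 /\ rho lambda mu * q < 1.

Definition admissible_fee (r p : R) : Prop := 0 <= p < r.

Definition customer_surplus (lambda mu r c p q : R) : R :=
  lambda * q * (r - p - c / (mu - lambda * q)).

Definition q_e_gr (lambda mu r c p : R) : R :=
  argmax (admissible_fraction lambda mu) (customer_surplus lambda mu r c p).

Definition revenue_gr (lambda mu r c p : R) : R :=
  lambda * q_e_gr lambda mu r c p * p.

(** When [nu <= 1] every fee yields zero revenue, and the fee is normalized
    to 0. *)
Definition p_r_gr (lambda mu r c : R) : R :=
  if Rle_dec (nu mu r c) 1 then 0
  else argmax (admissible_fee r) (revenue_gr lambda mu r c).

Definition q_r_gr (lambda mu r c : R) : R :=
  q_e_gr lambda mu r c (p_r_gr lambda mu r c).

Definition social_welfare (lambda mu r c q : R) : R :=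
  lambda * q * (r - c / (mu - lambda * q)).

Definition q_soc (lambda mu r c : R) : R :=
  argmax (admissible_fraction lambda mu) (social_welfare lambda mu r c).

(* Main.v *)
Require Import Defs.
From Stdlib Require Import Reals Lra ClassicalEpsilon.
Open Scope R_scope.

(** In terms of the spare capacity [y = mu - lambda * q], the surplus of
    customers with net reward [a] is [(mu - y) * (a - c / y)], which is strictly
    concave in [y] with stationary point [sqrt (c * mu / a)]; the joining
    fraction is obtained by clamping that point to [[mu - lambda, mu]].
    Parametrizing the fee by its stationary point [s], that is
    [p = r - c * mu / s ^ 2], the revenue on the unclamped range is
    [(mu - s) * (r - c * mu / s ^ 2)], again strictly concave, and its
    stationary point [t] is the root of the increasing cubic
    [r * s ^ 3 + c * mu * s - 2 * c * mu ^ 2].  The cubic is negative at the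
    socially optimal spare capacity [sqrt (c * mu / r)] and positive at [mu].
    So the revenue-maximizing spare capacity [Rmax t (mu - lambda)] strictly
    exceeds the socially optimal one unless both equal [mu - lambda]. *)

(** * Strict maximizers and admissible fractions *)

(** Strictness supplies the uniqueness without which the value of [argmax] is unspecified. *)
Lemma argmax_strict (D : R -> Prop) (f : R -> R) (x : R) :
  D x -> (forall y, D y -> y <> x -> f y < f x) -> argmax D f = x.
Proof.
intros Dx lt_fx.
assert (max_x : is_maximizer D f x).
{ split; [exact Dx|]. intros y Dy.
  destruct (Req_dec y x) as [->|ne]; [lra|]. left; auto. }
assert (uniq_x : unique (is_maximizer D f) x).
{ split; [exact max_x|]. intros y [Dy max_y].
  destruct (Req_dec y x) as [->|ne]; [reflexivity|].
  specialize (lt_fx y Dy ne). specialize (max_y x Dx). lra. }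
assert (spec : unique (is_maximizer D f) (argmax D f)).
{ unfold argmax. apply epsilon_spec. now exists x. }
now apply spec.
Qed.

Lemma admissible_fraction_iff (lambda mu q : R) :
  0 < mu ->
  admissible_fraction lambda mu q <-> 0 <= q <= 1 /\ lambda * q < mu.
Proof.
intros hmu. unfold admissible_fraction, rho.
replace (lambda / mu * q) with (lambda * q / mu) by (field; lra).
split; intros [hq h]; split; auto.
- apply (Rmult_lt_compat_r mu) in h; [|lra].
  replace (lambda * q / mu * mu) with (lambda * q) in h by (field; lra). lra.
- apply (Rmult_lt_reg_r mu); [lra|].
  replace (lambda * q / mu * mu) with (lambda * q) by (field; lra). lra.
Qed.

(** * Joining fractions as spare capacities *)

(** The ends [mu - lambda] and [mu] stand for full and no joining. If [lambda >= mu] the lower end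
    is not positive, so it never binds for [s > 0] and stability is automatic. *)
Definition clamped_capacity (lambda mu s : R) : R := Rmin mu (Rmax (mu - lambda) s).

Lemma clamped_capacity_ge (lambda mu s : R) :
  mu <= s -> clamped_capacity lambda mu s = mu.
Proof.
intros h. unfold clamped_capacity.
apply Rmin_left. apply Rle_trans with s; [exact h|apply Rmax_r].
Qed.

Lemma clamped_capacity_lt (lambda mu s : R) :
  0 < lambda -> s < mu -> clamped_capacity lambda mu s = Rmax (mu - lambda) s.
Proof.
intros hl h. unfold clamped_capacity.
apply Rmin_right. apply Rmax_lub; lra.
Qed.

(* First-order optimality of [y], in the form of a variational inequality. *)
Lemma surplus_capacity_lt (mu c a y z : R) :
  0 < mu -> 0 < c -> 0 < y -> 0 < z -> z <> y ->
  0 <= (z - y) * (a * y ^ 2 - c * mu) ->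
  (mu - z) * (a - c / z) < (mu - y) * (a - c / y).
Proof.
intros hmu hc hy hz ne opt.
apply Rlt_0_minus.
(* First-order term at [y], nonnegative by [opt], plus the gap between the convex [c * mu / z] and
   its tangent at [y]. *)
replace ((mu - y) * (a - c / y) - (mu - z) * (a - c / z))
  with ((z - y) * (a * y ^ 2 - c * mu) / y ^ 2
        + c * mu * (z - y) ^ 2 / (z * y ^ 2)) by (field; lra).
assert (0 < y ^ 2) by (apply pow_lt; lra).
assert (0 < (z - y) ^ 2) by (rewrite <- Rsqr_pow2; now apply Rsqr_pos_lt, Rminus_eq_contra).
apply Rplus_le_lt_0_compat.
- apply Rmult_le_pos; [exact opt|]. left. now apply Rinv_0_lt_compat.
- apply Rdiv_lt_0_compat; repeat first [assumption | lra | apply Rmult_lt_0_compat].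
Qed.

Lemma argmax_surplus (lambda mu c a : R) :
  0 < lambda -> 0 < mu -> 0 < c -> 0 < a ->
  argmax (admissible_fraction lambda mu)
         (fun q => lambda * q * (a - c / (mu - lambda * q))) =
  (mu - clamped_capacity lambda mu (sqrt (c * mu / a))) / lambda.
Proof.
intros hl hmu hc ha.
set (s := sqrt (c * mu / a)).
assert (hs : 0 < s).
{ apply sqrt_lt_R0, Rdiv_lt_0_compat; [now apply Rmult_lt_0_compat|lra]. }
assert (hs2 : a * s ^ 2 = c * mu).
{ unfold s. rewrite pow2_sqrt; [field; lra|].
  left; apply Rdiv_lt_0_compat; [now apply Rmult_lt_0_compat|lra]. }
set (y := clamped_capacity lambda mu s).
assert (bounds : 0 < y <= mu /\ mu - lambda <= y /\
  forall z, mu - lambda <= z <= mu -> 0 <= (z - y) * (a * y ^ 2 - c * mu)).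
{ rewrite <- hs2.
  destruct (Rle_lt_dec mu s) as [hms|hms].
  - assert (ey : y = mu) by now apply clamped_capacity_ge.
    rewrite ey. repeat split; try lra. intros z hz.
    replace ((z - mu) * (a * mu ^ 2 - a * s ^ 2))
      with ((mu - z) * a * ((s - mu) * (s + mu))) by ring.
    repeat apply Rmult_le_pos; lra.
  - assert (ey : y = Rmax (mu - lambda) s) by now apply clamped_capacity_lt.
    pose proof (Rmax_l (mu - lambda) s). pose proof (Rmax_r (mu - lambda) s).
    assert (Rmax (mu - lambda) s <= mu) by (apply Rmax_lub; lra).
    rewrite <- ey in *. repeat split; try lra. intros z hz.
    replace ((z - y) * (a * y ^ 2 - a * s ^ 2))
      with (a * (y + s) * ((z - y) * (y - s))) by ring.
    apply Rmult_le_pos; [apply Rmult_le_pos; lra|].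
    (* Either [y = s] and the product vanishes, or [y] is the lower end and both factors are
       nonnegative. *)
    destruct (Rle_lt_dec (mu - lambda) s) as [h|h].
    + rewrite Rmax_right in ey by lra. rewrite ey. lra.
    + rewrite Rmax_left in ey by lra. apply Rmult_le_pos; lra. }
destruct bounds as ([hy hymu] & hyl & opt).
assert (ly : lambda * ((mu - y) / lambda) = mu - y) by (field; lra).
apply argmax_strict.
- apply admissible_fraction_iff; [lra|]. rewrite ly.
  split; [|lra]. split.
  + apply (Rmult_le_reg_l lambda); lra.
  + apply (Rmult_le_reg_l lambda); lra.
- intros q Dq ne. destruct (proj1 (admissible_fraction_iff lambda mu q hmu) Dq) as [hq hlq].
  rewrite ly. replace (mu - (mu - y)) with y by ring.
  replace (lambda * q) with (mu - (mu - lambda * q)) at 1 by ring.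
  apply surplus_capacity_lt; try lra.
  + intros e. apply ne. rewrite <- e. field; lra.
  + apply opt. nra.
Qed.

Lemma q_e_gr_capacity (lambda mu r c p : R) :
  0 < lambda -> 0 < mu -> 0 < c -> p < r ->
  q_e_gr lambda mu r c p =
  (mu - clamped_capacity lambda mu (sqrt (c * mu / (r - p)))) / lambda.
Proof. intros. apply (argmax_surplus lambda mu c (r - p)); lra. Qed.

Lemma q_soc_capacity (lambda mu r c : R) :
  0 < lambda -> 0 < mu -> 0 < c -> 0 < r ->
  q_soc lambda mu r c =
  (mu - clamped_capacity lambda mu (sqrt (c * mu / r))) / lambda.
Proof. intros. now apply (argmax_surplus lambda mu c r). Qed.

Lemma revenue_gr_capacity (lambda mu r c p : R) :
  0 < lambda -> 0 < mu -> 0 < c -> p < r ->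
  revenue_gr lambda mu r c p =
  (mu - clamped_capacity lambda mu (sqrt (c * mu / (r - p)))) * p.
Proof.
intros. unfold revenue_gr. rewrite q_e_gr_capacity by assumption. field; lra.
Qed.

(** * The revenue-maximizing fee *)

(** Intermediate values: since [r * s ^ 2 = c * mu], the cubic at [s] collapses to
    [- 2 * c * mu * (mu - s)], and at [mu] it is [(r * mu - c) * mu ^ 2]. The condition
    [c < r * mu], that is [nu > 1], fixes both signs. *)
Lemma revenue_cubic_root (mu r c : R) :
  0 < mu -> 0 < r -> 0 < c -> c < r * mu ->
  exists t, sqrt (c * mu / r) < t < mu /\
            r * t ^ 3 + c * mu * t - 2 * c * mu ^ 2 = 0.
Proof.
intros hmu hr hc hnu.
set (s := sqrt (c * mu / r)).
assert (hcm : 0 < c * mu) by now apply Rmult_lt_0_compat.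
assert (hs2 : r * s ^ 2 = c * mu).
{ unfold s. rewrite pow2_sqrt; [field; lra|].
  left; apply Rdiv_lt_0_compat; lra. }
assert (hs : 0 < s) by (apply sqrt_lt_R0, Rdiv_lt_0_compat; lra).
assert (hsmu : s < mu).
{ destruct (Rlt_le_dec s mu) as [h|h]; [exact h|exfalso].
  assert (mu ^ 2 <= s ^ 2) by (apply pow_incr; lra).
  assert (r * mu ^ 2 <= r * s ^ 2) by (apply Rmult_le_compat_l; lra).
  assert (c * mu < r * mu * mu) by (apply Rmult_lt_compat_r; lra).
  nra. }
set (P := fun x => r * x ^ 3 + c * mu * x - 2 * c * mu ^ 2).
assert (Ps : P s < 0).
{ unfold P.
  replace (r * s ^ 3 + c * mu * s - 2 * c * mu ^ 2)
    with (- (2 * (c * mu) * (mu - s)))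
    by (replace (r * s ^ 3) with (r * s ^ 2 * s) by ring; rewrite hs2; ring).
  assert (0 < 2 * (c * mu) * (mu - s)) by (apply Rmult_lt_0_compat; lra). lra. }
assert (Pmu : 0 < P mu).
{ unfold P.
  replace (r * mu ^ 3 + c * mu * mu - 2 * c * mu ^ 2)
    with ((r * mu - c) * mu ^ 2) by ring.
  apply Rmult_lt_0_compat; [lra|apply pow_lt; lra]. }
assert (contP : continuity P) by (unfold P; reg).
destruct (IVT P s mu contP hsmu Ps Pmu) as (t & ht & Pt).
exists t. split; [|exact Pt].
split.
- destruct (proj1 ht) as [h|h]; [exact h|]. rewrite <- h in Pt. lra.
- destruct (proj2 ht) as [h|h]; [exact h|]. rewrite h in Pt. lra.
Qed.

(* The cubic at [m] is a negative multiple of the derivative of the revenue. *)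
Lemma revenue_capacity_lt (mu r c m s : R) :
  0 < c -> 0 < m -> 0 < s <= mu -> s <> m ->
  0 <= (s - m) * (r * m ^ 3 + c * mu * m - 2 * c * mu ^ 2) ->
  (mu - s) * (r - c * mu / s ^ 2) < (mu - m) * (r - c * mu / m ^ 2).
Proof.
intros hc hm hs ne opt.
apply Rlt_0_minus.
(* Again a first-order term plus a remainder, whose positivity relies on [s <= mu]. *)
replace ((mu - m) * (r - c * mu / m ^ 2) - (mu - s) * (r - c * mu / s ^ 2))
  with ((s - m) * (r * m ^ 3 + c * mu * m - 2 * c * mu ^ 2) / m ^ 3
        + c * mu * (s - m) ^ 2 * (m * (mu - s) + 2 * mu * s) / (s ^ 2 * m ^ 3))
  by (field; lra).
assert (0 < m ^ 3) by (apply pow_lt; lra).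
assert (0 < s ^ 2) by (apply pow_lt; lra).
assert (0 < (s - m) ^ 2) by (rewrite <- Rsqr_pow2; now apply Rsqr_pos_lt, Rminus_eq_contra).
apply Rplus_le_lt_0_compat.
- apply Rmult_le_pos; [exact opt|]. left. now apply Rinv_0_lt_compat.
- apply Rdiv_lt_0_compat; [|now apply Rmult_lt_0_compat].
  apply Rmult_lt_0_compat.
  + repeat first [assumption | lra | apply Rmult_lt_0_compat].
  + apply Rplus_le_lt_0_compat; [apply Rmult_le_pos; lra|].
    repeat first [assumption | lra | apply Rmult_lt_0_compat].
Qed.

(** Together with [fee_of_capacity], this makes fees below [r] and positive stationary points
    correspond bijectively. *)
Lemma sqrt_fee_capacity (mu c m : R) :
  0 < mu -> 0 < c -> 0 < m -> sqrt (c * mu / (c * mu / m ^ 2)) = m.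
Proof.
intros hmu hc hm.
replace (c * mu / (c * mu / m ^ 2)) with (m ^ 2) by (field; lra).
apply sqrt_pow2; lra.
Qed.

Lemma fee_of_capacity (mu r c p : R) :
  0 < mu -> 0 < c -> p < r ->
  p = r - c * mu / sqrt (c * mu / (r - p)) ^ 2.
Proof.
intros hmu hc hp.
assert (0 < c * mu) by now apply Rmult_lt_0_compat.
rewrite pow2_sqrt; [field; lra|].
left; apply Rdiv_lt_0_compat; lra.
Qed.

Lemma fee_capacity_lt (mu r c s m : R) :
  0 < mu -> 0 < c -> 0 < s -> s < m ->
  r - c * mu / s ^ 2 < r - c * mu / m ^ 2.
Proof.
intros hmu hc hs hsm.
assert (0 < c * mu) by now apply Rmult_lt_0_compat.
assert (/ m ^ 2 < / s ^ 2).
{ apply Rinv_lt_contravar; [|nra].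
  apply Rmult_lt_0_compat; apply pow_lt; lra. }
assert (c * mu * / m ^ 2 < c * mu * / s ^ 2) by (apply Rmult_lt_compat_l; lra).
unfold Rdiv; lra.
Qed.

(** Fees split by their stationary point [s]. For [s >= mu] nobody joins; for
    [mu - lambda <= s < mu] [revenue_capacity_lt] applies; for [s < mu - lambda] everybody joins,
    and the fee can be raised to that of [mu - lambda] without losing customers. *)
Lemma revenue_argmax (lambda mu r c t : R) :
  0 < lambda -> 0 < mu -> 0 < r -> 0 < c ->
  sqrt (c * mu / r) < t < mu ->
  r * t ^ 3 + c * mu * t - 2 * c * mu ^ 2 = 0 ->
  argmax (admissible_fee r) (revenue_gr lambda mu r c) =
  r - c * mu / Rmax (mu - lambda) t ^ 2.
Proof.
intros hl hmu hr hc [hst htmu] Pt.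
set (m := Rmax (mu - lambda) t).
assert (hcm : 0 < c * mu) by now apply Rmult_lt_0_compat.
assert (hs0 : 0 < sqrt (c * mu / r)) by (apply sqrt_lt_R0, Rdiv_lt_0_compat; lra).
assert (htm : t <= m) by apply Rmax_r.
assert (hlm : mu - lambda <= m) by apply Rmax_l.
assert (hmmu : m < mu) by (apply Rmax_lub_lt; lra).
(* The cubic vanishes if [m = t]; otherwise [m = mu - lambda] lies above its root, and [s >= m]. *)
assert (opt : forall s, mu - lambda <= s ->
  0 <= (s - m) * (r * m ^ 3 + c * mu * m - 2 * c * mu ^ 2)).
{ intros s hs. unfold m. destruct (Rle_lt_dec (mu - lambda) t) as [h|h].
  - rewrite Rmax_right by lra. rewrite Pt. lra.
  - rewrite Rmax_left by lra. apply Rmult_le_pos; [lra|].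
    assert (t ^ 3 <= (mu - lambda) ^ 3) by (apply pow_incr; lra).
    assert (r * t ^ 3 <= r * (mu - lambda) ^ 3) by (apply Rmult_le_compat_l; lra).
    assert (c * mu * t <= c * mu * (mu - lambda)) by (apply Rmult_le_compat_l; lra).
    lra. }
(* Fee 0 has stationary point [sqrt (c * mu / r)], which is below [m]. *)
assert (pos_p : 0 < r - c * mu / m ^ 2).
{ apply Rle_lt_trans with (r - c * mu / sqrt (c * mu / r) ^ 2).
  - right. pose proof (fee_of_capacity mu r c 0 hmu hc hr) as e.
    now rewrite Rminus_0_r in e.
  - apply fee_capacity_lt; lra. }
assert (lt_p : r - c * mu / m ^ 2 < r).
{ assert (0 < c * mu / m ^ 2) by (apply Rdiv_lt_0_compat; [|apply pow_lt]; lra).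
  lra. }
assert (rev_m : revenue_gr lambda mu r c (r - c * mu / m ^ 2) =
                (mu - m) * (r - c * mu / m ^ 2)).
{ rewrite revenue_gr_capacity by assumption.
  replace (r - (r - c * mu / m ^ 2)) with (c * mu / m ^ 2) by ring.
  rewrite sqrt_fee_capacity by lra.
  rewrite clamped_capacity_lt by lra. now rewrite Rmax_right by lra. }
apply argmax_strict.
- split; lra.
- intros p [hp0 hpr] ne.
  rewrite rev_m, revenue_gr_capacity by assumption.
  pose proof (fee_of_capacity mu r c p hmu hc hpr) as ep.
  assert (hs : 0 < sqrt (c * mu / (r - p)))
    by (apply sqrt_lt_R0, Rdiv_lt_0_compat; lra).
  set (s := sqrt (c * mu / (r - p))) in *.
  destruct (Rle_lt_dec mu s) as [hms|hms].
  + rewrite clamped_capacity_ge by assumption.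
    replace ((mu - mu) * p) with 0 by ring. apply Rmult_lt_0_compat; lra.
  + rewrite clamped_capacity_lt by assumption.
    assert (hsm : s <> m) by (intros e; apply ne; now rewrite ep, e).
    destruct (Rle_lt_dec (mu - lambda) s) as [h|h].
    * rewrite Rmax_right by lra. rewrite ep.
      apply revenue_capacity_lt; auto; lra.
    * rewrite Rmax_left by lra.
      assert (p < r - c * mu / (mu - lambda) ^ 2)
        by (rewrite ep; apply fee_capacity_lt; lra).
      apply Rlt_le_trans with
        ((mu - (mu - lambda)) * (r - c * mu / (mu - lambda) ^ 2)).
      { apply Rmult_lt_compat_l; lra. }
      destruct (Req_dec (mu - lambda) m) as [e|ne'].
      { rewrite e. lra. }
      left. apply revenue_capacity_lt; auto; try lra.
      apply opt; lra.
Qed.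

(** * Comparison of the two optima *)

Theorem mainTheorem3 (lambda mu r c : R)
  (hlambda : 0 < lambda) (hmu : 0 < mu) (hr : 0 < r) (hc : 0 < c) :
  (nu mu r c <= 1 ->
     q_r_gr lambda mu r c = 0 /\ q_soc lambda mu r c = 0) /\
  (1 < nu mu r c ->
     q_r_gr lambda mu r c <= q_soc lambda mu r c /\
     (q_r_gr lambda mu r c = q_soc lambda mu r c <->
        q_r_gr lambda mu r c = 1) /\
     0 < lambda * q_r_gr lambda mu r c *
           (r - p_r_gr lambda mu r c -
              c / (mu - lambda * q_r_gr lambda mu r c))).
Proof.
assert (hcm : 0 < c * mu) by now apply Rmult_lt_0_compat.
assert (nuE : r * mu = nu mu r c * c) by (unfold nu; field; lra).
split; intros hnu.
- assert (rmu : r * mu <= c) by nra.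
  (* Even at fee 0 the stationary point is at least [mu], so nobody joins. *)
  assert (hs : mu <= sqrt (c * mu / r)).
  { rewrite <- (sqrt_pow2 mu) at 1 by lra. apply sqrt_le_1_alt.
    apply (Rmult_le_reg_r r); [lra|].
    replace (c * mu / r * r) with (c * mu) by (field; lra). nra. }
  unfold q_r_gr, p_r_gr.
  destruct (Rle_dec (nu mu r c) 1) as [_|n]; [|contradiction].
  rewrite q_e_gr_capacity, q_soc_capacity by assumption.
  rewrite Rminus_0_r, clamped_capacity_ge by assumption.
  split; field; lra.
- assert (rmu : c < r * mu) by nra.
  destruct (revenue_cubic_root mu r c hmu hr hc rmu) as (t & ht & Pt).
  assert (pE : p_r_gr lambda mu r c = r - c * mu / Rmax (mu - lambda) t ^ 2).
  { unfold p_r_gr. destruct (Rle_dec (nu mu r c) 1) as [n|_]; [lra|].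
    now apply revenue_argmax. }
  set (m := Rmax (mu - lambda) t) in *.
  assert (hs0 : 0 < sqrt (c * mu / r)) by (apply sqrt_lt_R0, Rdiv_lt_0_compat; lra).
  assert (htm : t <= m) by apply Rmax_r.
  assert (hlm : mu - lambda <= m) by apply Rmax_l.
  assert (hmmu : m < mu) by (apply Rmax_lub_lt; lra).
  assert (hm2 : 0 < c * mu / m ^ 2) by (apply Rdiv_lt_0_compat; [|apply pow_lt]; lra).
  assert (qE : q_r_gr lambda mu r c = (mu - m) / lambda).
  { unfold q_r_gr. rewrite pE, q_e_gr_capacity by lra.
    replace (r - (r - c * mu / m ^ 2)) with (c * mu / m ^ 2) by ring.
    rewrite sqrt_fee_capacity by lra.
    rewrite clamped_capacity_lt by lra. now rewrite Rmax_right by lra. }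
  rewrite q_soc_capacity by assumption.
  rewrite clamped_capacity_lt by lra.
  rewrite qE, pE. clear pE qE.
  set (s := sqrt (c * mu / r)) in *.
  assert (hil : 0 < / lambda) by now apply Rinv_0_lt_compat.
  repeat split.
  + apply Rmult_le_compat_r; [lra|].
    assert (Rmax (mu - lambda) s <= m) by (apply Rmax_lub; lra). lra.
  + intros e. apply Rmult_eq_reg_r in e; [|lra].
    assert (em : m = Rmax (mu - lambda) s) by lra.
    (* If the social optimum is unclamped, then [m = s < t <= m], a contradiction. *)
    destruct (Rle_lt_dec (mu - lambda) s) as [h|h].
    * rewrite Rmax_right in em by lra. lra.
    * rewrite Rmax_left in em by lra. rewrite em. field; lra.
  + intros e.
    assert (em : m = mu - lambda).
    { apply (f_equal (Rmult lambda)) in e.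
      replace (lambda * ((mu - m) / lambda)) with (mu - m) in e by (field; lra).
      lra. }
    (* Here [s < t <= m = mu - lambda], so the social optimum is clamped too. *)
    rewrite (Rmax_left (mu - lambda) s) by lra. now rewrite em.
  + replace (lambda * ((mu - m) / lambda)) with (mu - m) by (field; lra).
    (* The net reward [c * mu / m ^ 2] exceeds the waiting cost [c / m] by
       [c * (mu - m) / m ^ 2]. *)
    replace ((mu - m) * (r - (r - c * mu / m ^ 2) - c / (mu - (mu - m))))
      with (c * (mu - m) ^ 2 / m ^ 2) by (field; lra).
    apply Rdiv_lt_0_compat; [|apply pow_lt; lra].
    apply Rmult_lt_0_compat; [lra|apply pow_lt; lra].
Qed.
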